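(* Let $k\geq 2$ be an integer and, for $n\geq 0$, let $f_{k,n}$ denote the number of cyclic even-up words over $k$ of length $n$. Let $F_k(x)=\sum_{n\geq 0}f_{k,n}x^n$. Then \[F_k(x)=1+x\left(\left\lfloor \frac{k}{2}\right\rfloor-\left\lfloor\frac{k+1}{2}\right\rfloor\frac{(x+1)^{\lfloor (k-1)/2\rfloor}}{(x+1)^{\lfloor (k+1)/2\rfloor}-2}\right).\]
   Context: For an integer $k\geq 2$, let $[k]=\{1,\ldots,k\}$. A word over $k$ of length $n$ is an element $w_1\cdots w_n\in[k]^n$. A word $w_1\cdots w_n$ with $n\geq 2$ is cyclic even-up if for every $i\in[n]$, whenever $w_i$ is even, $w_{i+1}>w_i$, where $w_{n+1}$ is defined to be $w_1$. By convention, the empty word (length $0$) and every word of length $1$ (i.e., each of the $k$ single letters) are counted as cyclic even-up. *)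

(* Defs.v *)
From HB Require Import structures.
From mathcomp Require Import all_boot all_order all_algebra.
From mathcomp Require Import boolp.

Set Implicit Arguments.
Unset Strict Implicit.
Unset Printing Implicit Defensive.

Import GRing.Theory.
Local Open Scope ring_scope.

(* The ring R[[x]] of formal power series: [FPS a] is \sum_n (a n) x^n. The
   classical layer boolp provides its equality and choice structures; the
   wrapper keeps the Cauchy product apart from the pointwise one on nat -> R. *)
Record fps (R : Type) := FPS { fps_coef : nat -> R }.

HB.instance Definition _ (R : Type) := gen_eqMixin (fps R).
HB.instance Definition _ (R : Type) := gen_choiceMixin (fps R).

Lemma fpsP (R : Type) (a b : fps R) : fps_coef a =1 fps_coef b -> a = b.
Proof. by case: a b => [f] [g] /= /funext->. Qed.

Section FpsZmodule.
Variable R : zmodType.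
Implicit Types a b c : fps R.

Definition fps_zero : fps R := FPS (fun _ => 0).
Definition fps_opp a : fps R := FPS (fun n => - fps_coef a n).
Definition fps_add a b : fps R := FPS (fun n => fps_coef a n + fps_coef b n).

Fact fps_addA : associative fps_add.
Proof. by move=> a b c; apply: fpsP => n /=; rewrite addrA. Qed.
Fact fps_addC : commutative fps_add.
Proof. by move=> a b; apply: fpsP => n /=; rewrite addrC. Qed.
Fact fps_add0 : left_id fps_zero fps_add.
Proof. by move=> a; apply: fpsP => n /=; rewrite add0r. Qed.
Fact fps_addN : left_inverse fps_zero fps_opp fps_add.
Proof. by move=> a; apply: fpsP => n /=; rewrite addNr. Qed.

HB.instance Definition _ :=
  GRing.isZmodule.Build (fps R) fps_addA fps_addC fps_add0 fps_addN.

End FpsZmodule.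

Section FpsComRing.
Variable R : comNzRingType.
Implicit Types a b c : fps R.

Definition fps_one : fps R := FPS (fun n => (n == 0)%N%:R).
Definition fps_mul a b : fps R :=
  FPS (fun n => \sum_(i < n.+1) fps_coef a i * fps_coef b (n - i)%N).

Definition fps_trunc m a : {poly R} := \poly_(i < m) fps_coef a i.

Lemma fps_coef_mul_trunc m n a b : (n < m)%N ->
  fps_coef (fps_mul a b) n = (fps_trunc m a * fps_trunc m b)`_n.
Proof.
move=> lt_nm; rewrite coefM; apply: eq_bigr => i _.
rewrite !coef_poly (leq_ltn_trans _ lt_nm) ?(leq_ltn_trans _ lt_nm) ?leq_subr //.
by rewrite -ltnS.
Qed.

Fact fps_mulC : commutative fps_mul.
Proof.
by move=> a b; apply: fpsP => n; rewrite !(@fps_coef_mul_trunc n.+1) // mulrC.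
Qed.
Fact fps_mulA : associative fps_mul.
Proof.
move=> a b c; apply: fpsP => n; rewrite !(@fps_coef_mul_trunc n.+1) //.
pose T := @fps_trunc n.+1; rewrite -!/(T _).
transitivity ((T a * (T b * T c))`_n).
  rewrite !coefM; apply: eq_bigr => i _; congr (_ * _).
  have lt_n : (n - i < n.+1)%N by rewrite ltnS leq_subr.
  by rewrite [LHS]coef_poly lt_n (fps_coef_mul_trunc _ _ lt_n).
rewrite mulrA 2!coefM; apply: eq_bigr => i _; congr (_ * _).
by rewrite [RHS]coef_poly ltn_ord (fps_coef_mul_trunc _ _ (ltn_ord i)).
Qed.
Fact fps_mul1 : left_id fps_one fps_mul.
Proof.
move=> a; apply: fpsP => n /=; rewrite big_ord_recl /= mul1r subn0 big1 ?addr0 //.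
by move=> i _; rewrite mul0r.
Qed.
Fact fps_mulDl : left_distributive fps_mul +%R.
Proof.
move=> a b c; apply: fpsP => n /=; rewrite -big_split /=.
by apply: eq_bigr => i _; rewrite mulrDl.
Qed.
Fact fps_one_neq0 : fps_one != 0.
Proof.
apply/eqP => /(congr1 (fun a : fps R => fps_coef a 0)) /= /eqP.
by rewrite oner_eq0.
Qed.

HB.instance Definition _ := GRing.Zmodule_isComNzRing.Build (fps R)
  fps_mulA fps_mulC fps_mul1 fps_mulDl fps_one_neq0.

Definition fpsX : fps R := FPS (fun n => (n == 1)%N%:R).

End FpsComRing.

Arguments fpsX R : clear implicits.

Section FpsUnitRing.
Variable R : comUnitRingType.
Implicit Types a b : fps R.

(* The first n coefficients of 1 / a, obtained by solving a * b = 1: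
   b_n = a_0^-1 ([n = 0] - \sum_(i < n) a_(n - i) b_i). *)
Fixpoint fps_inv_seq a n : seq R :=
  if n is m.+1 then
    let s := fps_inv_seq a m in
    rcons s ((fps_coef a 0)^-1 *
             ((m == 0)%N%:R - \sum_(i < m) fps_coef a (m - i)%N * s`_i))
  else [::].

Definition fps_unit : {pred fps R} := [pred a | fps_coef a 0 \is a GRing.unit].

(* As in every unitRingType, the inverse of a non-unit is itself. *)
Definition fps_inv a : fps R :=
  if a \in fps_unit then FPS (fun n => (fps_inv_seq a n.+1)`_n) else a.

Lemma size_fps_inv_seq a n : size (fps_inv_seq a n) = n.
Proof. by elim: n => //= n IHn; rewrite size_rcons IHn. Qed.

Lemma nth_fps_inv_seq a n i : (i < n)%N ->
  (fps_inv_seq a n)`_i = (fps_inv_seq a i.+1)`_i.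
Proof.
elim: n => // n IHn; rewrite ltnS leq_eqVlt => /predU1P[->//|lt_in].
by rewrite [LHS]nth_rcons size_fps_inv_seq lt_in IHn.
Qed.

Fact fps_mulVr : {in fps_unit, left_inverse 1 fps_inv *%R}.
Proof.
move=> a Ua; rewrite /fps_inv Ua; apply: fpsP => n.
rewrite [LHS]big_ord_recr /= subnn nth_rcons size_fps_inv_seq ltnn eqxx.
rewrite [X in _ + X]mulrC mulVKr // addrC -[RHS]addr0 -addrA; congr (_ + _).
rewrite addrC; apply/eqP; rewrite subr_eq0; apply/eqP; apply: eq_bigr => i _.
by rewrite mulrC -[rcons _ _]/(fps_inv_seq a i.+1) -(nth_fps_inv_seq a (ltn_ord i)).
Qed.

Fact fps_unitPl a b : b * a = 1 -> fps_unit a.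
Proof.
move=> /(congr1 (fun c : fps R => fps_coef c 0)) /=.
by rewrite big_ord1 mulrC => ba1; apply/unitrPr; exists (fps_coef b 0).
Qed.

Fact fps_inv_out : {in [predC fps_unit], fps_inv =1 id}.
Proof. by move=> a; rewrite inE /fps_inv => /negbTE->. Qed.

HB.instance Definition _ := GRing.ComNzRing_hasMulInverse.Build (fps R)
  fps_mulVr fps_unitPl fps_inv_out.

End FpsUnitRing.

(* The letters 1, ..., k are encoded by 'I_k, shifted by one. *)
Definition letter (k : nat) (a : 'I_k) : nat := a.+1.

(* [ordS i] is the cyclic successor of i in 'I_n. Words of length 0 and 1 are
   cyclic even-up by convention. *)
Definition cyclic_even_up (k n : nat) (w : n.-tuple 'I_k) : bool :=
  (n < 2)%N ||
  [forall i : 'I_n, ~~ odd (letter (tnth w i)) ==>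
     (letter (tnth w i) < letter (tnth w (ordS i)))%N].

Definition num_cyclic_even_up (k n : nat) : nat :=
  #|[set w : n.-tuple 'I_k | cyclic_even_up w]|.

Definition cyclic_even_up_gf (k : nat) : fps rat :=
  FPS (fun n => (num_cyclic_even_up k n)%:R).

(* Main.v *)
(* Cyclic even-up words of length n >= 2 are closed walks, so they number tr(A^n)
   with A = N + u v, where u is the indicator of the odd letters, v = (1,...,1),
   and N, which records the steps from an even letter to a larger one, is strictly
   upper triangular. For such a rank-one perturbation of a nilpotent matrix,
   \sum_(n >= 1) tr(A^n) x^n = x H'(x) / (1 - H(x)) with
   H(x) = \sum_m (v N^m u) x^(m+1). Here v N^m u counts the chains of m even letters
   ending below an odd letter; it equals C(c, m+1) with c the number of odd letters,
   so H = (1 + x)^c - 1. *)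
Require Import Defs.
From mathcomp Require Import all_boot all_order all_algebra.
From mathcomp Require Import zify.
Import GRing.Theory.
Local Open Scope ring_scope.

(** * Traces of powers of a rank-one perturbation *)

Section RankOnePerturbation.
Variables (R : comNzRingType) (k : nat) (N : 'M[R]_k) (u : 'cV[R]_k) (v : 'rV[R]_k).

Let A : 'M[R]_k := N + u *m v.
(** Interpolates between [h i], at [q = 0], and [b q.+1], at [i = 0]. *)
Let y i q := (v *m N ^+ i *m A ^+ q *m u) 0 0.
Let h m := (v *m N ^+ m *m u) 0 0.

(* The coefficients of 1 / (1 - x v (1 - x N)^-1 u) = 1 + x v (1 - x A)^-1 u. *)
Definition resolvent_coef (q : nat) : R :=
  if q is p.+1 then (v *m (N + u *m v) ^+ p *m u) 0 0 else 1.
Let b := resolvent_coef.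

(** Each product is split at its rightmost factor [u *m v]; the [i] factors after it are all [N]. *)
Lemma expmx_perturbation n :
  A ^+ n = N ^+ n + \sum_(i < n) A ^+ (n - i.+1) * (u *m v) * N ^+ i.
Proof.
elim: n => [|n IHn]; first by rewrite big_ord0 addr0 !expr0.
rewrite exprS IHn mulrDr mulr_sumr big_ord_recr /= subnn expr0 mul1r.
rewrite {1}/A mulrDl -exprS -addrA; congr (_ + _).
rewrite addrC; congr (_ + _); apply: eq_bigr => i _.
by rewrite !mulrA -exprS -subSn ?subSS.
Qed.

(** The leftmost [A] of [A ^+ q.+1] is either [N], which raises [i], or [u *m v], which cuts the
    scalar into [h i * b q.+1]. *)
Lemma mixed_coef i q : y i q = \sum_(i <= m < (i + q).+1) h m * b (i + q - m).
Proof.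
elim: q i => [|q IHq] i.
  by rewrite addn0 big_nat1 subnn /= mulr1 /y /h expr0 mulmx1.
have -> : y i q.+1 = y i.+1 q + h i * b q.+1.
  rewrite /y /h /= exprS -mulmxE /A mulmxDl mulmxDr mulmxDl mxE.
  rewrite exprSr -mulmxE; congr (_ + _); first by rewrite !mulmxA.
  by rewrite !mulmxA -2!(mulmxA (v *m N ^+ i *m u)) mxE big_ord1.
by rewrite IHq addSnnS [in RHS]big_ltn ?ltnS ?leq_addr // addrC addKn.
Qed.

(** Coefficient form of b = 1 + H b. *)
Lemma resolvent_coefS n : b n.+1 = \sum_(m < n.+1) h m * b (n - m).
Proof.
have -> : b n.+1 = y 0 n by rewrite /y /b /= expr0 mulmx1.
by rewrite mixed_coef add0n big_mkord.
Qed.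

(** Cyclicity of the trace turns the [i]-th term of the expansion into [y i (n - i)]. The product
    [h m * b (n - m)] then occurs once for each [i <= m], which produces the coefficients of H'. *)
Lemma mxtrace_perturbation n :
  \tr (A ^+ n.+1) =
  \tr (N ^+ n.+1) + \sum_(m < n.+1) (h m * b (n - m)) *+ m.+1.
Proof.
rewrite expmx_perturbation linearD /=; congr (_ + _).
rewrite linear_sum /=.
transitivity (\sum_(i < n.+1) \sum_(m < n.+1 | (i <= m)%N) h m * b (n - m)).
  apply: eq_bigr => i _.
  have le_in : (i <= n)%N by rewrite -ltnS.
  rewrite -!mulmxE -!mulmxA mxtrace_mulC -mulmxA mxtrace_mulC trace_mx11.
  rewrite -[LHS]/(y i (n - i)) mixed_coef subnKC //.
  by rewrite big_geq_mkord.
rewrite (exchange_big_dep predT) //=; apply: eq_bigr => m _.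
rewrite sumr_const; congr (_ *+ _).
rewrite -[RHS](card_ord m.+1) -!sum1_card.
by rewrite (big_ord_widen n.+1 (fun=> 1%N)) //; apply: eq_bigl => i; rewrite !inE ltnS.
Qed.

End RankOnePerturbation.

Arguments resolvent_coef {R k} N u v q.

(** * Words as closed walks, and chains of even letters *)

Section EvenUp.
Variable k : nat.

(** Stated on indices, which are letters minus one, so parity is flipped. *)
Definition even_up_rel : rel 'I_k := fun a b => ~~ odd a || (a < b)%N.

Lemma cyclic_even_up_cycle n (w : n.+2.-tuple 'I_k) :
  cyclic_even_up w = cycle even_up_rel w.
Proof.
case/tupleP: w => x p.
(* Appending [x] to [p] plays the role of the wrap-around modulo the length. *)
have stepE i : (i < n.+2)%N ->
    even_up_rel (nth x (x :: rcons p x) i) (nth x (rcons p x) i) =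
    even_up_rel (nth x (x :: p) i) (nth x (x :: p) (i.+1 %% n.+2)).
  move=> lt_i; rewrite -rcons_cons nth_rcons /= size_tuple lt_i.
  congr even_up_rel; rewrite nth_rcons size_tuple if_same.
  have [lt_in|le_ni] := ltnP i n.+1; first by rewrite modn_small.
  by have -> : i = n.+1; [lia | rewrite modnn].
have relE (i : 'I_n.+2) :
    (~~ odd (letter (tnth [tuple of x :: p] i)) ==>
     (letter (tnth [tuple of x :: p] i) < letter (tnth [tuple of x :: p] (ordS i)))%N) =
    even_up_rel (nth x (x :: rcons p x) i) (nth x (rcons p x) i).
  by rewrite stepE // !(tnth_nth x) /even_up_rel /letter /= negbK ltnS implybE.
apply/forallP/(pathP x) => [H i|H i].
  by rewrite size_rcons size_tuple => lt_i; rewrite -(relE (Ordinal lt_i)).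
by rewrite relE; apply: H; rewrite size_rcons size_tuple.
Qed.

Lemma big_tuple_cons (R : nmodType) (T : finType) n (F : n.+1.-tuple T -> R) :
  \sum_w F w = \sum_x \sum_(s : n.-tuple T) F [tuple of x :: s].
Proof.
rewrite pair_bigA /= (reindex (fun p : T * n.-tuple T => [tuple of p.1 :: p.2])) //=.
exists (fun w => (thead w, [tuple of behead w])) => [[x s] _|w _] /=.
  by rewrite theadE; congr pair; apply: val_inj.
by rewrite [RHS]tuple_eta.
Qed.

Lemma card_sum (T : finType) (P : pred T) :
  #|[set x | P x]|%:R = \sum_x (P x)%:R :> rat.
Proof.
by rewrite -sum1_card natr_sum big_mkcond; apply: eq_bigr => x _; rewrite inE; case: (P x).
Qed.

(** Transfer matrix: [s] lists the interior vertices of a walk of [n.+1] steps. *)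
Lemma card_path (e : rel 'I_k) n (a b : 'I_k) :
  #|[set s : n.-tuple 'I_k | path e a (rcons s b)]|%:R =
  ((\matrix_(i, j) (e i j)%:R : 'M[rat]_k) ^+ n.+1) a b.
Proof.
rewrite card_sum; elim: n a => [|n IHn] a.
  rewrite (big_pred1 [tuple]) => [|s]; last by apply/esym/eqP; exact: tuple0.
  by rewrite expr1 mxE /= andbT.
rewrite big_tuple_cons exprS -mulmxE mxE; apply: eq_bigr => x _.
rewrite -IHn mxE mulr_sumr; apply: eq_bigr => s _ /=.
by rewrite -natrM mulnb.
Qed.

Lemma card_cycle (e : rel 'I_k) n :
  #|[set w : n.+1.-tuple 'I_k | cycle e w]|%:R =
  \tr ((\matrix_(i, j) (e i j)%:R : 'M[rat]_k) ^+ n.+1).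
Proof.
rewrite card_sum big_tuple_cons; apply: eq_bigr => x _.
by rewrite -card_path card_sum.
Qed.

(* 'I_k encodes letters shifted by one: odd indices are even letters. *)
Definition even_step : 'M[rat]_k := \matrix_(a, b) (odd a && (a < b)%N)%:R.
Definition odd_letters : 'cV[rat]_k := \col_a (~~ odd a)%:R.
Definition all_letters : 'rV[rat]_k := const_mx 1.

Lemma even_up_decomp :
  \matrix_(a, b) (even_up_rel a b)%:R = even_step + odd_letters *m all_letters.
Proof.
apply/matrixP => a b; rewrite !mxE big_ord1 !mxE mulr1 /even_up_rel.
by case: (odd a); rewrite /= ?addr0 ?add0r.
Qed.

(** The diagonal case kills the trace; the range [b <= a] lets the induction pass to an intermediate
    index [c < b]. *)
Lemma expmx_even_step_diag n (a b : 'I_k) :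
  (b <= a)%N -> (even_step ^+ n.+1) a b = 0.
Proof.
elim: n b => [|n IHn] b le_ba; first by rewrite expr1 mxE ltnNge le_ba andbF.
rewrite exprSr -mulmxE mxE big1 // => c _; rewrite [even_step c b]mxE.
have [lt_cb|] := ltnP c b; last by rewrite andbF mulr0.
by rewrite IHn ?mul0r // (leq_trans (ltnW lt_cb)).
Qed.

(** Hockey-stick identity: the halves of the odd [a < n] are 0, ..., [n./2] - 1. *)
Lemma sum_bin_half_odd m n :
  (\sum_(a < n | odd a) 'C(a./2, m) = 'C(n./2, m.+1))%N.
Proof.
elim: n => [|n IHn]; first by rewrite big_ord0.
rewrite big_mkcond big_ord_recr -big_mkcond /= IHn uphalf_half.
by case: (odd n); rewrite ?addn0 ?add0n // add1n binS.
Qed.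

Lemma sum_bin_half_even m n :
  (\sum_(a < n | ~~ odd a) 'C(a./2, m) = 'C(uphalf n, m.+1))%N.
Proof.
elim: n => [|n IHn]; first by rewrite big_ord0.
rewrite big_mkcond big_ord_recr -big_mkcond /= IHn uphalf_half.
by case: (odd n); rewrite /= ?addn0 ?add0n ?add1n // binS.
Qed.

(** A chain is an [m]-subset of the [b./2] odd indices below [b]. *)
Lemma count_even_chains m (b : 'I_k) :
  (all_letters *m even_step ^+ m) 0 b = 'C(b./2, m)%:R.
Proof.
elim: m b => [|m IHm] b; first by rewrite expr0 mulmx1 mxE bin0.
rewrite exprSr -mulmxE mulmxA mxE -sum_bin_half_odd natr_sum.
rewrite (big_ord_widen_cond k (fun a => odd a) (fun a => 'C(a./2, m)%:R)); last exact: ltnW.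
rewrite [RHS]big_mkcond; apply: eq_bigr => a _; rewrite IHm mxE.
by case: ifP => _; rewrite ?mulr1 ?mulr0.
Qed.

Lemma count_even_chains_odd m :
  (all_letters *m even_step ^+ m *m odd_letters) 0 0 = 'C(uphalf k, m.+1)%:R.
Proof.
rewrite mxE -sum_bin_half_even natr_sum [RHS]big_mkcond; apply: eq_bigr => a _.
by rewrite count_even_chains mxE; case: ifP => _; rewrite ?mulr1 ?mulr0.
Qed.

End EvenUp.

(** * Coefficients of power series *)

Lemma fps_coefX0 (R : comNzRingType) (a : fps R) : fps_coef (fpsX R * a) 0 = 0.
Proof. by rewrite /= big_ord1 mul0r. Qed.

Lemma fps_coefXS (R : comNzRingType) (a : fps R) n :
  fps_coef (fpsX R * a) n.+1 = fps_coef a n.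
Proof.
rewrite /= big_ord_recl mul0r add0r big_ord_recl mul1r subSS subn0 big1 ?addr0 //.
by move=> i _; rewrite mul0r.
Qed.

Lemma fps_coefD (R : zmodType) (a b : fps R) n :
  fps_coef (a + b) n = fps_coef a n + fps_coef b n.
Proof. by []. Qed.

Lemma fps_coefM (R : comNzRingType) (a b : fps R) n :
  fps_coef (a * b) n = \sum_(i < n.+1) fps_coef a i * fps_coef b (n - i).
Proof. by []. Qed.

Lemma fps_coef1 (R : comNzRingType) n : fps_coef (1 : fps R) n = (n == 0)%N%:R.
Proof. by []. Qed.

Lemma fps_coef_expX1 (R : comNzRingType) c n :
  fps_coef ((fpsX R + 1) ^+ c) n = 'C(c, n)%:R.
Proof.
elim: c n => [|c IHc] n; first by rewrite expr0 bin0n.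
rewrite exprS mulrDl mul1r fps_coefD IHc.
case: n => [|n]; first by rewrite fps_coefX0 add0r !bin0.
by rewrite fps_coefXS IHc -natrD binS addnC.
Qed.

Lemma fps_coefMn (R : zmodType) (a : fps R) c n :
  fps_coef (a *+ c) n = fps_coef a n *+ c.
Proof. by elim: c => // c IHc; rewrite !mulrS fps_coefD IHc. Qed.

(** * The generating function in closed form *)

Section EvenUpSeries.
Variable k : nat.
Let c := uphalf k.
Let resolvent := FPS (resolvent_coef (even_step k) (odd_letters k) (all_letters k)).

(* The series (x + 1)^c - 2 is H - 1 in the notation of the header. *)
Lemma resolvent_inv : ((fpsX rat + 1) ^+ c - 2%:R) * - resolvent = 1.
Proof.
have coefD i : fps_coef ((fpsX rat + 1) ^+ c - 2%:R) i =
               'C(c, i)%:R - (i == 0)%N%:R *+ 2.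
  by rewrite fps_coefD fps_coef_expX1 -[2%:R]/(1 *+ 2) -fps_coef1 -fps_coefMn.
have coefN i : fps_coef (- resolvent) i = - fps_coef resolvent i by [].
apply: fpsP => n; rewrite fps_coefM big_ord_recl coefD bin0 subn0.
(* The constant term is 1 - 2 = -1 and the higher coefficients are those of H, so the recurrence
   [resolvent_coefS] remains. *)
rewrite mulr2n opprD addNKr coefN mulrNN mul1r fps_coef1.
case: n => [|n]; first by rewrite big_ord0 addr0.
rewrite [fps_coef resolvent _]resolvent_coefS.
apply/eqP; rewrite addr_eq0 -sumrN; apply/eqP/eq_bigr => i _.
rewrite lift0 subSS coefN coefD mul0rn subr0 count_even_chains_odd mulrN.
by rewrite opprK.
Qed.

(** This is H' / (1 - H), with H' = c (1 + x)^(c - 1); the shift to [n.+1] absorbs the factor x. *)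
Lemma tr_even_up :
  FPS (fun n => \tr ((\matrix_(a, b) (@even_up_rel k a b)%:R : 'M[rat]_k) ^+ n.+1)) =
  c%:R * (fpsX rat + 1) ^+ c.-1 * resolvent.
Proof.
apply: fpsP => n; rewrite fps_coefM [LHS]/= even_up_decomp mxtrace_perturbation.
rewrite [X in X + _]big1 ?add0r => [|a _]; last exact: expmx_even_step_diag.
apply: eq_bigr => m _; rewrite -mulrnAl; congr (_ * _).
rewrite count_even_chains_odd mulr_natl fps_coefMn fps_coef_expX1.
by rewrite -!mulrnA mulnC -mul_bin_diag mulnC.
Qed.

Lemma cyclic_even_up_gfE :
  cyclic_even_up_gf k =
  1 + fpsX rat * ((k./2)%:R + c%:R * (fpsX rat + 1) ^+ c.-1 * resolvent).
Proof.
rewrite -tr_even_up; apply: fpsP => n; rewrite fps_coefD fps_coef1.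
have cardT m : (m < 2)%N -> num_cyclic_even_up k m = (k ^ m)%N.
  move=> lt_m2; rewrite /num_cyclic_even_up -[k in RHS]card_ord -card_tuple.
  by rewrite -cardsT; apply: eq_card => w; rewrite !inE /cyclic_even_up lt_m2.
case: n => [|n]; first by rewrite fps_coefX0 addr0 /= cardT.
rewrite fps_coefXS add0r fps_coefD fps_coefMn fps_coef1 [LHS]/= [X in _ + X]/=.
case: n => [|n] /=.
  rewrite cardT // expn1 expr1.
  have -> : \tr (\matrix_(a, b) (@even_up_rel k a b)%:R : 'M[rat]_k) = c%:R.
    rewrite -[c]bin1 -(sum_bin_half_even 0) natr_sum [RHS]big_mkcond.
    apply: eq_bigr => a _; rewrite mxE /even_up_rel ltnn orbF bin0.
    by case: (odd a).
  by rewrite -natrD; congr (_%:R); lia.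
rewrite mul0rn add0r -card_cycle; congr (_%:R).
by apply: eq_card => w; rewrite !inE cyclic_even_up_cycle.
Qed.

End EvenUpSeries.

Theorem theorem3 (k : nat) (hk : (2 <= k)%N) :
  let x : fps rat := fpsX rat in
  cyclic_even_up_gf k =
    1 + x * ((k %/ 2)%:R
             - ((k + 1) %/ 2)%:R
               * ((x + 1) ^+ ((k - 1) %/ 2)
                  / ((x + 1) ^+ ((k + 1) %/ 2) - 2%:R))).
Proof.
move=> x.
have -> : ((k - 1) %/ 2 = (uphalf k).-1)%N by lia.
have -> : ((k + 1) %/ 2 = uphalf k)%N by lia.
have -> : (k %/ 2 = k./2)%N by lia.
set D := (x + 1) ^+ uphalf k - 2%:R.
have DR := resolvent_inv k; rewrite -/x -/D in DR.
have UD : D \is a GRing.unit by apply/unitrPr; eexists; exact: DR.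
(* By [DR], the inverse of [D] is minus the resolvent series, hence the minus sign in the
   statement. *)
rewrite cyclic_even_up_gfE -[D^-1]mulr1 -DR (mulKr UD).
by rewrite !mulrN opprK mulrA.
Qed.
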